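(* Let $\bar{x} \in \mathbf{X}_\lambda$. Then $\bar{x}$ is a solution of maximal $D$-support if and only if $\bar{x} \in \operatorname{ri} \mathbf{X}_\lambda$ (or equivalently, if and only if $\bar{x} \in \operatorname{ri} \mathbf{S}_\lambda$). In other words, $$\mathbf{S}_\lambda = \operatorname{ri} \mathbf{S}_\lambda = \operatorname{ri} \mathbf{X}_\lambda .$$
   Context: Let $n,p,q$ be positive integers, $y\in\mathbb{R}^q$, $\lambda>0$, $\Phi:\mathbb{R}^n\to\mathbb{R}^q$ linear, and $D:\mathbb{R}^p\to\mathbb{R}^n$ linear with adjoint (transpose) $D^*:\mathbb{R}^n\to\mathbb{R}^p$. Standing assumption: $\operatorname{Ker} D^*\cap\operatorname{Ker}\Phi=\{0\}$. Define the solution set $$\mathbf{X}_\lambda=\operatorname*{argmin}_{x\in\mathbb{R}^n}\ \tfrac12\|y-\Phi x\|_2^2+\lambda\|D^*x\|_1 .$$ For a vector $u\in\mathbb{R}^p$, $\operatorname{supp}(u)=\{i: u_i\neq0\}$ and $\|u\|_0=\operatorname{Card}(\operatorname{supp}(u))$. A vector $x^+$ is a solution of maximal $D$-support if $x^+\in\mathbf{X}_\lambda$ and $\|D^*x\|_0\le\|D^*x^+\|_0$ for every $x\in\mathbf{X}_\lambda$. The set of all solutions of maximal $D$-support is denoted $\mathbf{S}_\lambda$. For a set $S\subseteq\mathbb{R}^n$, $\operatorname{ri}S$ is its relative interior, i.e. the interior of $S$ with respect to the topology of its affine hull. *)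

(* Defs.v *)
From HB Require Import structures.
From mathcomp Require Import all_boot all_order all_algebra.
From mathcomp Require Import all_classical all_reals all_analysis.

Set Implicit Arguments.
Unset Strict Implicit.
Unset Printing Implicit Defensive.

Import Order.TTheory GRing.Theory Num.Theory.
Import numFieldNormedType.Exports.

Local Open Scope classical_set_scope.
Local Open Scope ring_scope.

Section Norms.
Context {R : realType} {m : nat}.
Implicit Types u : 'cV[R]_m.

Definition l1norm u : R := \sum_i `|u i 0|.

Definition l2norm u : R := Num.sqrt (\sum_i u i 0 ^+ 2).

Definition supp u : {set 'I_m} := [set i | u i 0 != 0]%SET.

Definition l0norm u : nat := #|supp u|.

End Norms.

Section RelativeInterior.
Context {R : realType} {n : nat}.
Implicit Types A S : set 'cV[R]_n.

Definition affine_set A : Prop :=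
  forall (x z : 'cV[R]_n) (t : R), A x -> A z -> A ((1 - t) *: x + t *: z).

Definition affine_hull S : set 'cV[R]_n :=
  \bigcap_(A in [set A | affine_set A /\ S `<=` A]) A.

(* [subspace A] is the type of the ambient space retopologized so that points
   of [A] carry the topology induced on [A] and points outside [A] are isolated.
   Since S `<=` affine_hull S, the latter points play no role here. *)
Definition relint S : set 'cV[R]_n :=
  @interior (subspace (affine_hull S)) S.

End RelativeInterior.

Definition argmin {R : realType} {T : Type} (f : T -> R) : set T :=
  [set x | forall z, f x <= f z].

Section Lasso.
Context {R : realType} {n p q : nat}.
Variables (y : 'cV[R]_q) (lambda : R) (Phi : 'M[R]_(q, n)) (D : 'M[R]_(n, p)).

Definition objective (x : 'cV[R]_n) : R :=
  2^-1 * l2norm (y - Phi *m x) ^+ 2 + lambda * l1norm (D^T *m x).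

Definition solutions : set 'cV[R]_n := argmin objective.

Definition maximal_D_support (x : 'cV[R]_n) : Prop :=
  solutions x /\
  forall z, solutions z -> (l0norm (D^T *m z) <= l0norm (D^T *m x))%N.

Definition max_support_solutions : set 'cV[R]_n :=
  [set x | maximal_D_support x].

End Lasso.

(* Main.v *)
Require Import Defs.
From HB Require Import structures.
From mathcomp Require Import all_boot all_order all_algebra.
From mathcomp Require Import all_classical all_reals all_analysis.
From mathcomp Require Import ring lra.

Set Implicit Arguments.
Unset Strict Implicit.
Unset Printing Implicit Defensive.

Import Order.TTheory GRing.Theory Num.Theory.
Import numFieldNormedType.Exports.

Local Open Scope classical_set_scope.
Local Open Scope ring_scope.

(** The objective is the sum of a squared Euclidean norm and an l1 norm. At the
    midpoint of x and z it falls below the mean of its values by one eighth of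
    the squared norm of Phi x - Phi z plus a multiple of the defect in the
    triangle inequalities between D^T x and D^T z ([objective_midpoint]). Both
    losses vanish when x and z are solutions ([solutions_midpoint]). Hence
    solutions share the value Phi x and the norm of D^T x, these two values
    characterize them ([solutionsP]), and D^T x, D^T z never have opposite signs
    at any index ([solutions_sign]). As nothing cancels in D^T x + D^T z, the
    support of the midpoint is the union of the two supports, so a support of
    maximal cardinality contains all the others ([maximal_D_supportP]).

    If x has maximal support, the l1 norm is linear on the set of solutions: it
    pairs D^T z with the signs of D^T x. So the affine hull of the solutions lies
    in the flat on which Phi, the zero pattern and this pairing are those of x
    ([solutions_sub_sign_flat]). Near x no sign can change on the support, and
    every point of that flat is again a solution, with the same support as x
    ([near_max_support_solutions]); this makes x interior to the solutions and
    also to the solutions of maximal support.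

    Conversely, if x is relatively interior, the segment from any solution z to
    x can be prolonged beyond x to a solution w. At an index where D^T x vanishes
    and D^T z does not, D^T w and D^T z would have opposite signs, so the support
    of D^T z is contained in that of D^T x ([relint_solutions_sub]). *)

(** * Affine hulls and relative interiors *)

Section RelintFacts.
Context {R : realType} {n : nat}.
Implicit Types (A S : set 'cV[R]_n) (x z : 'cV[R]_n).

Lemma sub_affine_hull S : S `<=` affine_hull S.
Proof. by move=> x Sx A [_]; exact. Qed.

Lemma affine_hull_min S A : affine_set A -> S `<=` A -> affine_hull S `<=` A.
Proof. by move=> affA SA x; apply. Qed.

Lemma affine_hullS S A : S `<=` A -> affine_hull S `<=` affine_hull A.
Proof. by move=> SA x Sx B [affB AB]; apply: Sx; split=> // z /SA/AB. Qed.

Lemma affine_set_hull S : affine_set (affine_hull S).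
Proof. by move=> x z t Sx Sz A SA; apply: SA.1; [exact: Sx|exact: Sz]. Qed.

(** The hull topology at a point of S is the trace of the ambient one, so the
    isolated points outside the hull never matter. *)
Lemma relintP S x :
  relint S x <-> S x /\ (\forall z \near x, affine_hull S z -> S z).
Proof.
rewrite /relint /interior; split.
  move=> Sx; have Sx0 : S x by exact: (nbhs_subspace_singleton Sx).
  split=> //; move: Sx.
  by rewrite {1}/nbhs /= -nbhs_subspace_in //; exact: sub_affine_hull.
case=> Sx nS; rewrite {1}/nbhs /= -nbhs_subspace_in //.
exact: sub_affine_hull.
Qed.

(** This is how relative interiority is used: segments ending at x can be
    prolonged a little. *)
Lemma near_ray_beyond x z (P : set 'cV[R]_n) :
  (\forall w \near x, P w) -> exists2 e : R, 0 < e & P (x + e *: (x - z)).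
Proof.
move=> nP; have cv : x + e *: (x - z) @[e --> (0 : R)^'+] --> x.
  apply: cvg_at_right_filter; rewrite -[in X in _ --> X](addr0 x).
  apply: cvgD; first exact: cvg_cst.
  by rewrite -(scale0r (x - z)); apply: cvgZr_tmp; exact: cvg_id.
have /cv nP' := nP.
near (0 : R)^'+ => e.
exists e; first by near: e; exact: nbhs_right_gt.
by near: e.
Unshelve. all: by end_near.
Qed.

End RelintFacts.

(** * Midpoint identities for the two norms *)

Section Norms.
Context {R : realType}.

Lemma l2norm_sqr m (u : 'cV[R]_m) : l2norm u ^+ 2 = \sum_i u i 0 ^+ 2.
Proof. by rewrite sqr_sqrtr // sumr_ge0 // => i _; rewrite sqr_ge0. Qed.

Lemma l2norm_sqr_eq0 m (u : 'cV[R]_m) : l2norm u ^+ 2 = 0 -> u = 0.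
Proof.
rewrite l2norm_sqr => u0; apply/colP => i; rewrite mxE.
apply/eqP; rewrite -sqrf_eq0; apply/eqP.
by apply: (psumr_eq0P _ u0) => // j _; rewrite sqr_ge0.
Qed.

(** The parallelogram law, which gives strict convexity. *)
Lemma l2norm_midpoint m (u v : 'cV[R]_m) :
  l2norm (2^-1 *: (u + v)) ^+ 2 =
  2^-1 * (l2norm u ^+ 2 + l2norm v ^+ 2) - 4^-1 * l2norm (u - v) ^+ 2.
Proof.
rewrite !l2norm_sqr -big_split !mulr_sumr -sumrB /=.
by apply: eq_bigr => i _; rewrite !mxE; field.
Qed.

(** The total defect in the entrywise triangle inequalities: it measures how far
    the l1 norm is from being additive at u and v. *)
Definition l1gap m (u v : 'cV[R]_m) : R :=
  \sum_i (`|u i 0| + `|v i 0| - `|u i 0 + v i 0|).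

Lemma l1norm_midpoint m (u v : 'cV[R]_m) :
  l1norm (2^-1 *: (u + v)) =
  2^-1 * (l1norm u + l1norm v) - 2^-1 * l1gap u v.
Proof.
rewrite /l1norm /l1gap -big_split !mulr_sumr -sumrB /=.
apply: eq_bigr => i _; rewrite !mxE normrM ger0_norm ?invr_ge0 //.
by ring.
Qed.

Lemma l1gap_ge0 m (u v : 'cV[R]_m) : 0 <= l1gap u v.
Proof. by apply: sumr_ge0 => i _; rewrite subr_ge0 ler_normD. Qed.

Lemma l1gap_eq0 m (u v : 'cV[R]_m) i :
  l1gap u v = 0 -> `|u i 0 + v i 0| = `|u i 0| + `|v i 0|.
Proof.
move=> g0; apply/esym/eqP; rewrite -subr_eq0; apply/eqP.
by apply: (psumr_eq0P _ g0) => // j _; rewrite subr_ge0 ler_normD.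
Qed.

Lemma normrD_eq_mulr_ge0 (a b : R) : `|a + b| = `|a| + `|b| -> 0 <= a * b.
Proof.
move=> /(congr1 (fun c => c ^+ 2)).
rewrite real_normK ?num_real // [in RHS]sqrrD !real_normK ?num_real //.
by rewrite -normrM => E; have := normr_ge0 (a * b); nra.
Qed.

Lemma normr_sgM (a b : R) :
  0 <= a * b -> (a = 0 -> b = 0) -> `|b| = Num.sg a * b.
Proof.
case: (sgrP a) => [->|a0|a0] /=; first by move=> _ ->; rewrite ?normr0 ?mulr0.
- by rewrite pmulr_rge0 // mul1r => b0 _; rewrite ger0_norm.
- by rewrite nmulr_rge0 // mulN1r => b0 _; rewrite ler0_norm.
Qed.

Lemma in_supp m (u : 'cV[R]_m) i : (i \in supp u) = (u i 0 != 0).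
Proof. by rewrite inE. Qed.

End Norms.

Section Continuity.
Context {R : realType} {m n : nat}.

Lemma mulmx_coord_cvg (A : 'M[R]_(m, n)) (x : 'cV[R]_n) i :
  (A *m z) i 0 @[z --> x] --> (A *m x) i 0.
Proof.
rewrite mxE; under eq_cvg do rewrite mxE.
apply: cvg_big => [||j _]; [exact: add_continuous|exact: nbhs_filter|].
by apply: (@cvgMl_tmp _ _ _ (nbhs_filter x)); exact: coord_continuous.
Qed.

Lemma near_mulmx_sign (A : 'M[R]_(m, n)) (x : 'cV[R]_n) :
  \forall z \near x, forall i,
    (A *m x) i 0 != 0 -> 0 < (A *m x) i 0 * (A *m z) i 0.
Proof.
have Fx := nbhs_filter x.
apply: (@filter_forall _ _ (fun i z => (A *m x) i 0 != 0 ->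
  0 < (A *m x) i 0 * (A *m z) i 0) (nbhs x) Fx) => i.
have [->|xi0] := eqVneq ((A *m x) i 0) 0; first by near=> z.
have cAx := @cvgMl_tmp _ _ _ Fx _ ((A *m x) i 0) _ (@mulmx_coord_cvg A x i).
have pos : 0 < (A *m x) i 0 * (A *m x) i 0.
  by rewrite -expr2 exprn_even_gt0 //= xi0.
by apply: filterS (cvgr_gt _ cAx 0 pos).
Unshelve. all: by end_near.
Qed.

End Continuity.

(** * Solutions and their supports *)

Section Lasso.
Context {R : realType} {n p q : nat}.
Context (y : 'cV[R]_q) (lambda : R) (Phi : 'M[R]_(q, n)) (D : 'M[R]_(n, p)).
Context (lambda_gt0 : 0 < lambda).
Implicit Types x z : 'cV[R]_n.

Local Notation obj := (objective y lambda Phi D).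
Local Notation X := (solutions y lambda Phi D).
Local Notation S := (max_support_solutions y lambda Phi D).

(** Convexity with an exact remainder: the last two terms are the losses whose
    vanishing constrains pairs of solutions. *)
Lemma objective_midpoint x z :
  obj (2^-1 *: (x + z)) = 2^-1 * (obj x + obj z)
    - 8^-1 * l2norm (Phi *m z - Phi *m x) ^+ 2
    - 2^-1 * lambda * l1gap (D^T *m x) (D^T *m z).
Proof.
rewrite /objective -!scalemxAr !mulmxDr l1norm_midpoint.
have -> : y - 2^-1 *: (Phi *m x + Phi *m z) =
    2^-1 *: ((y - Phi *m x) + (y - Phi *m z)).
  by apply/colP => i; rewrite !mxE; field.
rewrite l2norm_midpoint.
have -> : y - Phi *m x - (y - Phi *m z) = Phi *m z - Phi *m x.
  by apply/colP => i; rewrite !mxE; ring.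
by field.
Qed.

Lemma solutions_objective_eq x z : X x -> X z -> obj x = obj z.
Proof. by move=> Xx Xz; apply/eqP; rewrite eq_le Xx Xz. Qed.

(** The midpoint cannot beat the common minimum, which forces both nonnegative
    losses to be zero. *)
Lemma solutions_midpoint x z : X x -> X z ->
  [/\ X (2^-1 *: (x + z)), Phi *m x = Phi *m z
    & l1gap (D^T *m x) (D^T *m z) = 0].
Proof.
move=> Xx Xz; have Exz := solutions_objective_eq Xx Xz.
have := Xx (2^-1 *: (x + z)); have := objective_midpoint x z.
have := l1gap_ge0 (D^T *m x) (D^T *m z).
set g := l1gap _ _; set r := l2norm _ ^+ 2 => g0 Em le_m.
have r0 : 0 <= r by rewrite sqr_ge0.
have lg0 : 0 <= lambda * g by rewrite mulr_ge0 // ltW.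
have rE : r = 0 by lra.
have lgE : lambda * g = 0 by lra.
split.
- move=> w; apply: le_trans (Xx w); lra.
- by move/l2norm_sqr_eq0/eqP: rE; rewrite subr_eq0 => /eqP.
- by move/eqP: lgE; rewrite mulf_eq0 gt_eqF //= => /eqP.
Qed.

Lemma solutions_normD x z i : X x -> X z ->
  `|(D^T *m x) i 0 + (D^T *m z) i 0| = `|(D^T *m x) i 0| + `|(D^T *m z) i 0|.
Proof. by move=> Xx Xz; apply: l1gap_eq0; case: (solutions_midpoint Xx Xz). Qed.

Lemma solutions_sign x z i : X x -> X z ->
  0 <= (D^T *m x) i 0 * (D^T *m z) i 0.
Proof. by move=> Xx Xz; apply/normrD_eq_mulr_ge0/solutions_normD. Qed.

Lemma solutionsP x z : X x ->
  X z <-> Phi *m z = Phi *m x /\ l1norm (D^T *m z) = l1norm (D^T *m x).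
Proof.
move=> Xx; split=> [Xz|[PE lE] w]; last by rewrite /objective PE lE; exact: Xx.
have [_ PE _] := solutions_midpoint Xz Xx; split=> //.
have := solutions_objective_eq Xz Xx; rewrite /objective PE => /addrI.
by move/mulfI => -> //; rewrite gt_eqF.
Qed.

(** Maximality in cardinality is maximality for inclusion, because the midpoint
    of two solutions is a solution supported on the union of the supports. *)
Lemma maximal_D_supportP x : X x -> maximal_D_support y lambda Phi D x <->
  forall z, X z -> supp (D^T *m z) \subset supp (D^T *m x).
Proof.
move=> Xx; split=> [[_ xmax] z Xz|supx]; last first.
  by split=> // z Xz; exact/subset_leq_card/supx.
have [Xm _ _] := solutions_midpoint Xx Xz.
(* No entry of D^T x + D^T z cancels. *)
have suppm i : (i \in supp (D^T *m (2^-1 *: (x + z)))) =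
    (i \in supp (D^T *m x)) || (i \in supp (D^T *m z)).
  have := solutions_normD i Xx Xz; rewrite !in_supp -scalemxAr mulmxDr.
  move: (D^T *m x) (D^T *m z) => u v uvE.
  rewrite !mxE mulf_eq0 invr_eq0 pnatr_eq0 /= -normr_eq0 uvE.
  by rewrite paddr_eq0 // !normr_eq0 negb_and.
have sub : supp (D^T *m x) \subset supp (D^T *m (2^-1 *: (x + z))).
  by apply/fintype.subsetP => i ix; rewrite suppm ix.
have /eqP -> : supp (D^T *m x) == supp (D^T *m (2^-1 *: (x + z))).
  by rewrite eqEcard sub; exact: xmax.
by apply/fintype.subsetP => i iz; rewrite suppm iz orbT.
Qed.

(** An affine subspace on which, close to x, the l1 norm of D^T z is constant: its
    last equation fixes that norm as long as D^T z keeps the signs of D^T x. *)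
Definition sign_flat x : set 'cV[R]_n :=
  [set z | [/\ Phi *m z = Phi *m x,
     forall i, (D^T *m x) i 0 = 0 -> (D^T *m z) i 0 = 0
   & \sum_i Num.sg ((D^T *m x) i 0) * (D^T *m z) i 0 = l1norm (D^T *m x)]].

Lemma affine_sign_flat x : affine_set (sign_flat x).
Proof.
move=> a b t [aP a0 aS] [bP b0 bS]; rewrite /sign_flat /=.
rewrite !mulmxDr -!scalemxAr; split.
- by rewrite aP bP -scalerDl subrK scale1r.
- move=> i xi; have := a0 i xi; have := b0 i xi.
  move: (D^T *m a) (D^T *m b) => u v vi ui.
  by rewrite !mxE ui vi !mulr0 addr0.
- transitivity ((1 - t) * l1norm (D^T *m x) + t * l1norm (D^T *m x)).
    rewrite -{1}aS -bS !mulr_sumr -big_split /=; apply: eq_bigr => i _.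
    move: (D^T *m a) (D^T *m b) (D^T *m x) => u v w.
    by rewrite !mxE; ring.
  by ring.
Qed.

(** Maximality of x gives the zero pattern, and compatible signs turn the norm
    of D^T z into its pairing with the signs of D^T x. *)
Lemma solutions_sub_sign_flat x : S x -> X `<=` sign_flat x.
Proof.
move=> Sx z Xz; have Xx := Sx.1; have [PE lE] := (solutionsP z Xx).1 Xz.
have x0 i : (D^T *m x) i 0 = 0 -> (D^T *m z) i 0 = 0.
  move=> xi; apply/eqP; move/eqP: xi; apply: contraTT => zi.
  have /fintype.subsetP/(_ i) : supp (D^T *m z) \subset supp (D^T *m x).
    exact: (maximal_D_supportP Xx).1 Sx z Xz.
  by rewrite !in_supp; apply.
split=> //; rewrite -lE; apply: eq_bigr => i _; apply/esym.
by apply: normr_sgM (x0 i); exact: solutions_sign.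
Qed.

(** Points of the hull lie in [sign_flat x]; close to x they keep the nonzero
    signs of D^T x, so their l1 norm is again minimal and no index leaves the
    support. *)
Lemma near_max_support_solutions x :
  S x -> \forall z \near x, affine_hull X z -> S z.
Proof.
move=> Sx; have Xx := Sx.1; near=> z => aXz.
have [PE z0 zS] : sign_flat x z.
  apply: affine_hull_min aXz; first exact: affine_sign_flat.
  exact: solutions_sub_sign_flat.
have zpos : forall i, (D^T *m x) i 0 != 0 ->
    0 < (D^T *m x) i 0 * (D^T *m z) i 0.
  by near: z; exact: near_mulmx_sign.
have Xz : X z.
  apply/(solutionsP z Xx); split=> //; rewrite -zS; apply: eq_bigr => i _.
  apply: normr_sgM (z0 i).
  have [->|/zpos/ltW //] := eqVneq ((D^T *m x) i 0) 0.
  by rewrite mul0r.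
apply/(maximal_D_supportP Xz) => w Xw.
apply: fintype.subset_trans ((maximal_D_supportP Xx).1 Sx w Xw) _.
apply/fintype.subsetP => i; rewrite !in_supp => /zpos.
by apply: contraTneq => ->; rewrite mulr0 ltxx.
Unshelve. all: by end_near.
Qed.

(** Prolonging from z beyond x flips the sign of D^T z wherever D^T x is zero,
    and two solutions cannot have opposite signs. *)
Lemma relint_solutions_sub : relint X `<=` S.
Proof.
move=> x /relintP [Xx nX]; apply/(maximal_D_supportP Xx) => z Xz.
have [e e0 Xw] := near_ray_beyond z nX.
have {}Xw : X (x + e *: (x - z)).
  apply: Xw; have -> : x + e *: (x - z) = (1 - - e) *: x + (- e) *: z.
    by apply/colP => i; rewrite !mxE; ring.
  by apply: affine_set_hull; exact: sub_affine_hull.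
apply/fintype.subsetP => i; rewrite !in_supp; apply: contraNN => /eqP xi.
have := solutions_sign i Xw Xz; rewrite mulmxDr -scalemxAr mulmxBr.
move: (D^T *m x) (D^T *m z) xi => u v ui; rewrite !mxE ui.
rewrite add0r add0r mulrN mulNr oppr_ge0 -mulrA.
by rewrite pmulr_rle0 // -expr2 => le0; rewrite -sqrf_eq0 eq_le le0 sqr_ge0.
Qed.

Lemma sub_relint_solutions : S `<=` relint X.
Proof.
move=> x Sx; apply/relintP; split; first exact: Sx.1.
by apply: filterS (near_max_support_solutions Sx) => z Sz /Sz [].
Qed.

Lemma sub_relint_max_support : S `<=` relint S.
Proof.
move=> x Sx; apply/relintP; split=> //.
apply: filterS (near_max_support_solutions Sx) => z Sz aSz; apply: Sz.
by apply: affine_hullS aSz => w [].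
Qed.

End Lasso.

Theorem theorem2p2 (R : realType) (n p q : nat)
    (hn : (0 < n)%N) (hp : (0 < p)%N) (hq : (0 < q)%N)
    (y : 'cV[R]_q) (lambda : R) (hlambda : 0 < lambda)
    (Phi : 'M[R]_(q, n)) (D : 'M[R]_(n, p))
    (hker : [set x : 'cV[R]_n | D^T *m x = 0] `&`
            [set x : 'cV[R]_n | Phi *m x = 0] = [set 0]) :
  let X := solutions y lambda Phi D in
  let S := max_support_solutions y lambda Phi D in
  [/\ forall xbar : 'cV[R]_n, X xbar ->
        (maximal_D_support y lambda Phi D xbar <-> relint X xbar) /\
        (maximal_D_support y lambda Phi D xbar <-> relint S xbar),
      S = relint S
    & relint S = relint X].
Proof.
move=> X S.
have SX : S = relint X.
  apply/seteqP; split; first exact: sub_relint_solutions.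
  exact: relint_solutions_sub.
have SS : S = relint S.
  apply/seteqP; split; first exact: sub_relint_max_support.
  by move=> x /relintP[].
split; [move=> x _|exact: SS|by rewrite -SS].
by split; [rewrite -SX|rewrite -SS].
Qed.
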